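(* Let $k$ be a field equipped with a non-Archimedean absolute value $v\colon k\to\mathbb{R}_{\ge 0}$, let $R$ be a finitely generated $k$-algebra and $X=\operatorname{Spec}R$. Then there are natural homeomorphisms $$X^{\mathrm{an}}\;\cong\;X(\mathbb{T})\;\cong\;\lim_{\iota}Y_\iota(\mathbb{T})\;\cong\;\lim_{\iota}\operatorname{Trop}(X,\iota),$$ where $\mathbb{T}$ is the tropical band, and the limits run over all closed embeddings $\iota\colon X\hookrightarrow\mathbb{A}^{n(\iota)}_k$, with toric morphisms $\phi\colon\mathbb{A}^{n(\iota)}_k\to\mathbb{A}^{n(\jmath)}_k$ satisfying $\jmath=\phi\circ\iota$ as arrows $\iota\to\jmath$.
   Context: **Bands.** A pointed monoid is a commutative (multiplicative) monoid $B$ with an absorbing element $0$. Its ambient semiring $B^+$ is the semiring $\mathbb{N}[B]$ of finite formal sums of elements of $B$ modulo the identification of the element $0\in B$ with the empty sum. A band is a pair $(B,N_B)$ with $B$ a pointed monoid and $N_B\subseteq B^+$ (the null set) an ideal of $B^+$ (i.e. $0\in N_B$, $N_B+N_B\subseteq N_B$, $B^+N_B\subseteq N_B$) such that for every $a\in B$ there is a unique $b\in B$ with $a+b\in N_B$. A morphism of bands $f\colon B\to C$ is a monoid morphism with $f(0)=0$ such that $\sum b_i\in N_B$ implies $\sum f(b_i)\in N_C$. **Bandification.** A commutative ring $R$ gives the band $\underline{R}$ with underlying monoid $(R,\cdot)$ and null set $N_{\underline{R}}=\{\sum a_i\in R^+ : \sum a_i=0\text{ in }R\}$. A $\underline{k}$-band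 is a band $B$ with a band morphism $\underline{k}\to B$; $\operatorname{Hom}_{\underline{k}}$ denotes band morphisms compatible with these. **Tropical band.** $\mathbb{T}$ has underlying monoid $(\mathbb{R}_{\ge0},\cdot)$ and null set $N_{\mathbb{T}}=\{0\}\cup\{\sum a_i : \max\{a_i\}\text{ occurs at least twice}\}$. It carries the order topology (the usual topology of $\mathbb{R}_{\ge 0}$). The absolute value $v$ is a band morphism $\underline{k}\to\mathbb{T}$, making $\mathbb{T}$ a $\underline{k}$-band. **Band scheme models.** A closed embedding $\iota\colon X\hookrightarrow\mathbb{A}^n_k$ is the same as a list of $k$-algebra generators $a_1,\dots,a_n$ of $R$. The $\underline{k}$-band $R_\iota\subseteq\underline{R}$ has underlying monoid $\{c\,a_1^{e_1}\cdots a_n^{e_n}: c\in k,\ e_i\in\mathbb{N}\}\subseteq R$ and null set $N_{R_\iota}=N_{\underline{R}}\cap R_\iota^+$. $Y_\iota=\operatorname{Spec}(R_\iota)$ is the associated affine band scheme. **Points.** $X(\mathbb{T})=\operatorname{Hom}_{\underline{k}}(\underline{R},\mathbb{T})$ and $Y_\iota(\mathbb{T})=\operatorname{Hom}_{\underline{k}}(R_\iota,\mathbb{T})$, each with the initial topology for the evaluation maps $f\mapsto f(a)$. **Toric morphisms and transition maps.** A toric morphism $\phi\colon\mathbb{A}^n_k\to\mathbb{A}^m_k$ is one for which the pullback of each coordinate function is a monomial in the coordinate functions. If $\jmath=\phi\circ\iota$ then $R_\jmath\subseteq R_\iota$, and the transition map $Y_\iota(\mathbb{T})\to Y_\jmath(\mathbb{T})$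 is restriction along this inclusion; the transition map $\operatorname{Trop}(X,\iota)\to\operatorname{Trop}(X,\jmath)$ is given by the corresponding monomial map $\mathbb{R}_{\ge0}^{n}\to\mathbb{R}_{\ge0}^{m}$. Limits carry the inverse limit topology. **Analytification and tropicalization.** $X^{\mathrm{an}}$ is the Berkovich analytification: the set of multiplicative seminorms $|\cdot|\colon R\to\mathbb{R}_{\ge0}$ satisfying $|f+g|\le\max(|f|,|g|)$ and extending $v$ on $k$, with the coarsest topology making all maps $|\cdot|\mapsto|f|$, $f\in R$, continuous. For $\iota$ given by $a_1,\dots,a_n$, $\operatorname{Trop}(X,\iota)\subseteq\mathbb{R}_{\ge0}^n$ (multiplicative convention, zero coordinates allowed) is the image of the map $X^{\mathrm{an}}\to\mathbb{R}_{\ge0}^n$, $|\cdot|\mapsto(|a_1|,\dots,|a_n|)$, with the subspace topology. *)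

(* Defs.v *)
From HB Require Import structures.
From mathcomp Require Import all_boot all_order all_algebra.
From mathcomp Require Import all_classical all_reals all_analysis.

Set Implicit Arguments.
Unset Strict Implicit.
Unset Printing Implicit Defensive.

Import Order.TTheory GRing.Theory Num.Theory.
Import numFieldNormedType.Exports.

Local Open Scope classical_set_scope.
Local Open Scope ring_scope.

Record pointedMonoid := PointedMonoid {
  pm_sort :> choiceType;
  pm_one : pm_sort;
  pm_zero : pm_sort;
  pm_mul : pm_sort -> pm_sort -> pm_sort;
  pm_mulA : associative pm_mul;
  pm_mulC : commutative pm_mul;
  pm_mul1 : left_id pm_one pm_mul;
  pm_mul0 : left_zero pm_zero pm_mul }.

(* The ambient semiring B^+ = N[B]/(0_B) is represented by finite sequences
   modulo [amb_eq]: sequences up to permutation are the elements of N[B], and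
   dropping the terms 0_B realizes the identification of 0_B with the empty
   sum.  The sum of two classes is concatenation, the product is [amb_mul]. *)
Definition amb_eq (B : pointedMonoid) (s t : seq B) : bool :=
  perm_eq [seq x <- s | x != pm_zero B] [seq x <- t | x != pm_zero B].

Definition amb_mul (B : pointedMonoid) (s t : seq B) : seq B :=
  [seq pm_mul x y | x <- s, y <- t].

(* [null_eq] says that [null] is a subset of B^+, i.e. a saturated set of
   representatives. *)
Record band := Band {
  band_monoid :> pointedMonoid;
  null : set (seq band_monoid);
  null_eq : forall s t, amb_eq s t -> null s -> null t;
  null0 : null [::];
  nullD : forall s t, null s -> null t -> null (s ++ t);
  nullM : forall s t, null t -> null (amb_mul s t);
  null_opp : forall a, exists! b, null [:: a; b] }.

Record bandHom (B C : band) := BandHom {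
  bh_fun :> B -> C;
  bh0 : bh_fun (pm_zero B) = pm_zero C;
  bh1 : bh_fun (pm_one B) = pm_one C;
  bhM : forall x y, bh_fun (pm_mul x y) = pm_mul (bh_fun x) (bh_fun y);
  bh_null : forall s, null s -> null (map bh_fun s) }.

Record bandUnder (K : band) := BandUnder {
  bu_band :> band;
  bu_str : bandHom K bu_band }.

Record homUnder (K : band) (B C : bandUnder K) := HomUnder {
  hu_hom :> bandHom B C;
  hu_str : forall c, hu_hom (bu_str B c) = bu_str C c }.

Section Composition.
Variables (K : band) (B C D : bandUnder K).
Variables (g : homUnder C D) (f : homUnder B C).

Let comp0 : (g \o f) (pm_zero B) = pm_zero D.
Proof. by rewrite /= !bh0. Qed.

Let comp1 : (g \o f) (pm_one B) = pm_one D.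
Proof. by rewrite /= !bh1. Qed.

Let compM x y : (g \o f) (pm_mul x y) = pm_mul ((g \o f) x) ((g \o f) y).
Proof. by rewrite /= !bhM. Qed.

Let comp_null s : null s -> null (map (g \o f) s).
Proof. by move=> ns; rewrite map_comp; do 2! apply: bh_null. Qed.

Let comp_str c : (g \o f) (bu_str B c) = bu_str D c.
Proof. by rewrite /= !hu_str. Qed.

Definition hu_comp : homUnder B D :=
  @HomUnder K B D (BandHom comp0 comp1 compM comp_null) comp_str.

End Composition.

Section Subband.
Variable B : band.

(* A pointed submonoid of [B] closed under taking the additive inverse given
   by the band structure; it inherits the null set N_B \cap S^+. *)
Record subband := Subband {
  sb_set : set B;
  sb0 : sb_set (pm_zero B);
  sb1 : sb_set (pm_one B);
  sbM : forall x y, sb_set x -> sb_set y -> sb_set (pm_mul x y);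
  sbN : forall x y, sb_set x -> null [:: x; y] -> sb_set y }.

Variable S : subband.

Definition sb_elt x (Sx : sb_set S x) : set_type (sb_set S) :=
  exist _ x (mem_set Sx).

Definition sb_mul (x y : set_type (sb_set S)) : set_type (sb_set S) :=
  sb_elt (sbM (set_mem (valP x)) (set_mem (valP y))).

Let sb_mulA : associative sb_mul.
Proof. by move=> x y z; apply: val_inj; rewrite /= pm_mulA. Qed.
Let sb_mulC : commutative sb_mul.
Proof. by move=> x y; apply: val_inj; rewrite /= pm_mulC. Qed.
Let sb_mul1 : left_id (sb_elt (sb1 S)) sb_mul.
Proof. by move=> x; apply: val_inj; rewrite /= pm_mul1. Qed.
Let sb_mul0 : left_zero (sb_elt (sb0 S)) sb_mul.
Proof. by move=> x; apply: val_inj; rewrite /= pm_mul0. Qed.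

Definition sb_monoid : pointedMonoid :=
  @PointedMonoid (set_type (sb_set S) : choiceType) _ _
    sb_mul sb_mulA sb_mulC sb_mul1 sb_mul0.

Definition sb_val (x : sb_monoid) : B := val x.

Definition sb_null : set (seq sb_monoid) := [set s | null (map sb_val s)].

Let sb_null_eq s t : amb_eq s t -> sb_null s -> sb_null t.
Proof.
rewrite /amb_eq /sb_null /= => st; apply: null_eq; rewrite /amb_eq !filter_map.
by apply: perm_map; exact: st.
Qed.

Let sb_null0 : sb_null [::].
Proof. exact: null0. Qed.

Let sb_nullD s t : sb_null s -> sb_null t -> sb_null (s ++ t).
Proof. by rewrite /sb_null /= map_cat; exact: nullD. Qed.

Let sb_nullM s t : sb_null t -> sb_null (amb_mul s t).
Proof.
rewrite /sb_null /= /amb_mul map_allpairs => /(@nullM B (map sb_val s)).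
by rewrite /amb_mul allpairs_mapl allpairs_mapr.
Qed.

Let sb_null_opp a : exists! b, sb_null [:: a; b].
Proof.
have [b [nab ub]] := null_opp (sb_val a).
exists (sb_elt (sbN (set_mem (valP a)) nab)); split=> //.
by move=> c nac; apply: val_inj; apply: ub.
Qed.

Definition sb_band : band :=
  @Band sb_monoid sb_null sb_null_eq sb_null0 sb_nullD sb_nullM sb_null_opp.

End Subband.

Section Bandification.
Variable A : comPzRingType.

Definition ring_monoid : pointedMonoid :=
  @PointedMonoid A 1 0 *%R (@mulrA A) (@mulrC A) (@mul1r A) (@mul0r A).

Definition ring_null : set (seq ring_monoid) := [set s | \sum_(x <- s) x = 0].

Let sum_nz (s : seq ring_monoid) :
  \sum_(x <- s) x = \sum_(x <- s | x != pm_zero ring_monoid) x.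
Proof.
rewrite (bigID (fun x => x == pm_zero ring_monoid)) /= big1 ?add0r //.
by move=> x /eqP ->.
Qed.

Let rnull_eq s t : amb_eq s t -> ring_null s -> ring_null t.
Proof.
rewrite /ring_null /= /amb_eq => st.
by rewrite !sum_nz -!(big_filter _ (fun x => x != _)) (perm_big _ st).
Qed.

Let rnull0 : ring_null [::].
Proof. by rewrite /ring_null /= big_nil. Qed.

Let rnullD s t : ring_null s -> ring_null t -> ring_null (s ++ t).
Proof. by rewrite /ring_null /= big_cat /= => -> ->; rewrite addr0. Qed.

Let rnullM s t : ring_null t -> ring_null (amb_mul s t).
Proof.
rewrite /ring_null /= => t0; rewrite /amb_mul big_allpairs_dep big1 // => x _.
by rewrite -mulr_sumr t0 mulr0.
Qed.

Let rnull_opp a : exists! b, ring_null [:: a; b].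
Proof.
exists (- (a : A)); split.
  by rewrite /ring_null /= !big_cons big_nil /= addr0 subrr.
move=> b; rewrite /ring_null /= !big_cons big_nil addr0 => ab.
by apply/eqP; rewrite eq_sym -addr_eq0 addrC ab.
Qed.

Definition bandification : band :=
  @Band ring_monoid ring_null rnull_eq rnull0 rnullD rnullM rnull_opp.

End Bandification.

Definition nnreal (R : realType) : Type := {nonneg R}.

HB.instance Definition _ (R : realType) := Choice.on (nnreal R).
HB.instance Definition _ (R : realType) :=
  Topological.copy (nnreal R)
    (initial_topology (fun x : nnreal R => x%:num : R)).

Section Tropical.
Variable R : realType.
Implicit Types (x y : nnreal R) (s t : seq (nnreal R)).

Definition nn0 : nnreal R := 0%:nng.
Definition nn1 : nnreal R := 1%:nng.
Definition nnmul x y : nnreal R := (x%:num * y%:num)%:nng.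

Let nnmulA : associative nnmul.
Proof. by move=> x y z; apply: val_inj; rewrite /= mulrA. Qed.
Let nnmulC : commutative nnmul.
Proof. by move=> x y; apply: val_inj; rewrite /= mulrC. Qed.
Let nnmul1 : left_id nn1 nnmul.
Proof. by move=> x; apply: val_inj; rewrite /= mul1r. Qed.
Let nnmul0 : left_zero nn0 nnmul.
Proof. by move=> x; apply: val_inj; rewrite /= mul0r. Qed.

Definition trop_monoid : pointedMonoid :=
  PointedMonoid nnmulA nnmulC nnmul1 nnmul0.

Definition nnmax s : R := \big[Num.max/0]_(x <- s) x%:num.

(* The first disjunct says that the class of [s] in the ambient semiring
   is 0. *)
Definition trop_null : set (seq trop_monoid) :=
  [set s : seq trop_monoid | amb_eq s [::] \/
           (2 <= count (fun x : nnreal R => x%:num == nnmax s) s)%N].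


Lemma nnmax_ge0 s : 0 <= nnmax s.
Proof.
rewrite /nnmax; elim: s => [|x s IH]; first by rewrite big_nil.
by rewrite big_cons le_max IH orbT.
Qed.

Let nnmax_cat s t : nnmax (s ++ t) = Num.max (nnmax s) (nnmax t).
Proof.
elim: s => [|x s IH] /=.
  by rewrite [nnmax [::]]/nnmax big_nil; apply/esym/max_idPr; exact: nnmax_ge0.
by rewrite /nnmax !big_cons -!/(nnmax _) IH maxA.
Qed.

Lemma nnmax_ub s x : x \in s -> x%:num <= nnmax s.
Proof.
rewrite /nnmax; elim: s => // y s IH; rewrite inE big_cons le_max.
by case/orP => [/eqP <-|/IH ->]; rewrite ?lexx ?orbT.
Qed.

Lemma nnmax_att s : 0 < nnmax s -> exists2 x, x \in s & x%:num = nnmax s.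
Proof.
rewrite /nnmax; elim: s => [|y s IH]; first by rewrite big_nil ltxx.
rewrite big_cons; case: (leP y%:num) => [ys M0|_ _]; last first.
  by exists y; rewrite ?mem_head.
by have [x xs <-] := IH M0; exists x => //; rewrite inE xs orbT.
Qed.

Let amb0P s : amb_eq (B := trop_monoid) s [::] <-> nnmax s = 0.
Proof.
rewrite /amb_eq /=; split => [/perm_nilP s0|M0].
  apply/eqP; case: (eqVneq (nnmax s) 0) => // M0.
  have [|x xs xM] := @nnmax_att s; first by rewrite lt_def M0 nnmax_ge0.
  have : x \in [seq x <- s | x != pm_zero trop_monoid].
    rewrite mem_filter; apply/andP; split; last exact: xs.
    by apply/eqP => x0; move: M0; rewrite -xM x0 /= eqxx.
  by rewrite s0.
apply/perm_nilP/eqP; rewrite -[_ == _]negbK -has_filter.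
apply/hasPn => x xs; rewrite negbK; apply/eqP/val_inj => /=.
have := nnmax_ub xs; rewrite M0 => x0; apply: le_anti.
by rewrite x0 /=.
Qed.

Lemma trop_nullP s : trop_null s <->
  nnmax s = 0 \/ (2 <= count (fun x : nnreal R => x%:num == nnmax s) s)%N.
Proof.
by split=> -[/amb0P h|h]; [left|right|left|right].
Qed.

Let nnmax_filter s : nnmax [seq x <- s | x != nn0] = nnmax s.
Proof.
rewrite /nnmax; elim: s => //= x s IH; rewrite big_cons.
have [->|_] /= := eqVneq x nn0; last by rewrite big_cons IH.
by rewrite IH; apply/esym/max_idPr; exact: nnmax_ge0.
Qed.

Let trop_null_eq s t :
  amb_eq (B := trop_monoid) s t -> trop_null s -> trop_null t.
Proof.
move=> st /trop_nullP h; apply/trop_nullP.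
have Mst : nnmax s = nnmax t.
  rewrite -nnmax_filter -[RHS]nnmax_filter; apply: perm_big; exact: st.
case: h => [|h]; first by left; rewrite -Mst.
have [M0|M0] := eqVneq (nnmax t) 0; [by left|right].
have cnt u : count (fun x : nnreal R => x%:num == nnmax t) u =
    count (fun x : nnreal R => x%:num == nnmax t) [seq x <- u | x != nn0].
  rewrite count_filter; apply: eq_count => x /=.
  have [->|_] := eqVneq x nn0; rewrite ?andbT //= ?andbF.
  by apply/eqP => e; move: M0; rewrite -e eqxx.
rewrite cnt; move: h; rewrite Mst cnt; congr (_ <= _)%N.
exact: (permP st).
Qed.

Let trop_nullD s t : trop_null s -> trop_null t -> trop_null (s ++ t).
Proof.
move=> /trop_nullP hs /trop_nullP ht; apply/trop_nullP.
rewrite nnmax_cat count_cat; have [_|/ltW _] := leP (nnmax s) (nnmax t).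
  by case: ht => h; [left|right; exact: leq_trans h (leq_addl _ _)].
by case: hs => h; [left|right; exact: leq_trans h (leq_addr _ _)].
Qed.

Let nnmax_map x t : nnmax (map (nnmul x) t) = x%:num * nnmax t.
Proof.
rewrite /nnmax big_map; elim: t => [|y t IH]; first by rewrite !big_nil mulr0.
by rewrite !big_cons IH maxr_pMr.
Qed.

Let amb_mul_cons x s t : amb_mul (B := trop_monoid) (x :: s) t =
  map (nnmul x) t ++ amb_mul (B := trop_monoid) s t.
Proof. by []. Qed.

Let nnmax_mul s t :
  nnmax (amb_mul (B := trop_monoid) s t) = nnmax s * nnmax t.
Proof.
elim: s => [|x s IH]; first by rewrite /nnmax !big_nil mul0r.
rewrite amb_mul_cons nnmax_cat IH nnmax_map /nnmax big_cons.
by rewrite [RHS]mulrC maxr_pMr ?nnmax_ge0 // mulrC [_ * \big[_/_]_(_ <- s) _]mulrC.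
Qed.

Let trop_nullM s t : trop_null t -> trop_null (amb_mul (B := trop_monoid) s t).
Proof.
move=> /trop_nullP ht; apply/trop_nullP; rewrite nnmax_mul.
case: ht => [->|ht]; first by left; rewrite mulr0.
have [s0|s0] := eqVneq (nnmax s) 0; [by left; rewrite s0 mul0r|right].
have [|x xs <-] := @nnmax_att s; first by rewrite lt_def s0 nnmax_ge0.
apply: leq_trans ht _; elim: s xs {s0} => // y s IH.
rewrite inE amb_mul_cons count_cat => /orP[/eqP <-|/IH h]; last first.
  exact: leq_trans h (leq_addl _ _).
apply: leq_trans (leq_addr _ _); rewrite count_map; apply: sub_count => z /=.
by move=> /eqP ->.
Qed.

Let trop_null_opp (a : trop_monoid) : exists! b, trop_null [:: a; b].
Proof.
exists a; split.
  apply/trop_nullP; right; rewrite /nnmax !big_cons big_nil /=.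
  by rewrite maxA maxxx (max_idPl _) // eqxx.
move=> b /trop_nullP; rewrite /nnmax !big_cons big_nil /=.
rewrite [Num.max b%:num _](max_idPl _) // => -[h|].
  have a0 : a%:num <= 0 by rewrite -h le_max lexx.
  have b0 : b%:num <= 0 by rewrite -h le_max lexx orbT.
  have [a0' b0'] : 0 <= a%:num /\ 0 <= b%:num by [].
  by apply/val_inj/le_anti/andP; split;
    [exact: le_trans a0 b0'|exact: le_trans b0 a0'].
have [_|_] := leP a%:num b%:num.
  by rewrite eqxx; case: eqP => // h _; apply: val_inj.
by rewrite eqxx; case: eqP => // h _; apply: val_inj.
Qed.

Let trop_null0 : trop_null [::].
Proof. by left. Qed.

Definition trop_band : band :=
  @Band trop_monoid trop_null trop_null_eq trop_null0 trop_nullD trop_nullM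
    trop_null_opp.

End Tropical.

Section AbsoluteValue.
Variables (R : realType) (k : fieldType).

Record nonarchAbs := NonarchAbs {
  absv :> k -> nnreal R;
  absv_eq0 : forall x, (absv x)%:num = 0 <-> x = 0;
  absvM : forall x y, (absv (x * y))%:num = (absv x)%:num * (absv y)%:num;
  absv_ultra : forall x y,
    (absv (x + y))%:num <= Num.max (absv x)%:num (absv y)%:num }.

Variable v : nonarchAbs.

Lemma absv0 : v 0 = nn0 R.
Proof. by apply: val_inj => /=; apply/absv_eq0. Qed.

Lemma absv1 : v 1 = nn1 R.
Proof.
apply: val_inj => /=; have := absvM v 1 1; rewrite mulr1 => h.
have n0 : (v 1)%:num != 0.
  by apply/eqP => /absv_eq0 /eqP; rewrite oner_eq0.
by apply: (mulfI n0); rewrite -h mulr1.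
Qed.

Let absvN x : v (- x) = v x.
Proof.
apply: val_inj => /=; apply/eqP.
rewrite -(@eqrXn2 _ 2) // !expr2 -!absvM mulrNN //.
Qed.

Let absv_sum (r : seq k) (M : R) : 0 < M ->
  (forall x, x \in r -> (v x)%:num < M) -> (v (\sum_(x <- r) x))%:num < M.
Proof.
move=> M0; elim: r => [|x r IH] rM; first by rewrite big_nil absv0.
rewrite big_cons; apply: le_lt_trans (absv_ultra _ _ _) _.
rewrite gt_max rM ?mem_head // IH // => y yr; apply: rM.
by rewrite inE yr orbT.
Qed.

Let absv_null (s : seq (bandification k)) : null s -> trop_null (map v s).
Proof.
rewrite /= /ring_null /= => s0; apply/trop_nullP.
have [M0|M0] := eqVneq (nnmax (map v s)) 0; [by left|right].
have Mgt : 0 < nnmax (map v s) by rewrite lt_def M0 nnmax_ge0.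
have [_ /mapP[x xs ->] xM] := nnmax_att Mgt.
have ps := perm_to_rem xs.
rewrite count_map (permP ps) /= xM eqxx add1n ltnS -has_count.
apply: contraPT s0 => /hasPn h; rewrite (perm_big _ ps) /= big_cons => /eqP.
rewrite addr_eq0 => /eqP xE.
have : (v (\sum_(y <- rem x s) y))%:num < nnmax (map v s).
  apply: absv_sum => // y yr; rewrite lt_neqAle; apply/andP; split.
    exact: h.
  by apply/nnmax_ub/map_f; exact: mem_rem yr.
by rewrite -absvN -xE xM ltxx.
Qed.

Let absv_mul x y : v (x * y) = nnmul (v x) (v y).
Proof. by apply: val_inj; exact: absvM. Qed.

Definition absv_hom : bandHom (bandification k) (trop_band R) :=
  @BandHom (bandification k) (trop_band R) v absv0 absv1
    absv_mul absv_null.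

Definition tropUnder : bandUnder (bandification k) :=
  @BandUnder (bandification k) (trop_band R) absv_hom.

End AbsoluteValue.

Definition homeomorphism (X Y : topologicalType) (f : X -> Y) : Prop :=
  exists g : Y -> X, [/\ cancel f g, cancel g f, continuous f & continuous g].

Section InverseLimit.
Variables (I : Type) (Ar : I -> I -> Type) (X : I -> topologicalType).
Variable tr : forall i j, Ar i j -> X i -> X j.

Definition invlim_set : set (prod_topology X) :=
  [set x | forall i j (h : Ar i j), tr h (x i) = x j].

(* A subtype of the product; [set_type] carries the subspace topology. *)
Definition invlim : topologicalType := set_type invlim_set.

Definition invlim_proj (i : I) (x : invlim) : X i := set_val x i.

End InverseLimit.

(* A [k]-algebra is a ring morphism [alg : k -> A] to a commutative, possibly
   zero, ring. *)
Section Algebra.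
Variables (R : realType) (k : fieldType) (v : nonarchAbs R k).
Variables (A : comPzRingType) (alg : {rmorphism k -> A}).

Local Notation kband := (bandification k).

Let alg_null (s : seq kband) :
  null s -> null (map (alg : kband -> bandification A) s).
Proof.
rewrite /= /ring_null /= => s0.
by rewrite big_map -(raddf_sum alg) s0 raddf0.
Qed.

Definition alg_hom : bandHom kband (bandification A) :=
  @BandHom kband (bandification A) alg (rmorph0 alg) (rmorph1 alg)
    (rmorphM alg) alg_null.

Definition algUnder : bandUnder kband := BandUnder alg_hom.

Definition points (B : bandUnder kband) : Type := homUnder B (tropUnder v).

HB.instance Definition _ B := gen_eqMixin (points B).
HB.instance Definition _ B := gen_choiceMixin (points B).

Definition ev (B : bandUnder kband) (b : B) (f : points B) : nnreal R := f b.

HB.instance Definition _ (B : bandUnder kband) :=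
  Topological.copy (points B)
    (sup_topology (fun b : B =>
       Topological.class (initial_topology (@ev B b)))).

(* |0| = 0 and |1| = 1 follow from [seminorm_ext]. *)
Record berkovich : Type := Berkovich {
  seminorm :> A -> nnreal R;
  seminormM : forall f g,
    (seminorm (f * g))%:num = (seminorm f)%:num * (seminorm g)%:num;
  seminorm_ultra : forall f g,
    (seminorm (f + g))%:num <= Num.max (seminorm f)%:num (seminorm g)%:num;
  seminorm_ext : forall c, seminorm (alg c) = v c }.

HB.instance Definition _ := gen_eqMixin berkovich.
HB.instance Definition _ := gen_choiceMixin berkovich.
HB.instance Definition _ :=
  Topological.copy berkovich
    (sup_topology (fun f : A =>
       Topological.class (initial_topology (fun x : berkovich => x f)))).

(* The smallest [k]-subalgebra containing the [a i] is the whole ring. *)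
Definition generates n (a : 'I_n -> A) : Prop :=
  forall S : set A,
    (forall c, S (alg c)) -> (forall i, S (a i)) ->
    (forall x y, S x -> S y -> S (x + y)) ->
    (forall x y, S x -> S y -> S (x * y)) ->
    forall x, S x.

Definition finitely_generated : Prop :=
  exists n (a : 'I_n -> A), generates a.

Record closedEmbedding : Type := ClosedEmbedding {
  edim : nat;
  egen : 'I_edim -> A;
  egenP : generates egen }.

Arguments egen : clear implicits.

Implicit Types i j : closedEmbedding.

(* A toric morphism A^n -> A^m is given by its matrix [e] of exponents: the
   pullback of the [q]-th coordinate is the product over [p] of the powers
   x_p ^ e_(q, p), without scalar coefficient.  [toricP] says that j is the
   composite of i with this morphism. *)
Record toricArrow i j : Type := ToricArrow {
  toric_exp : 'I_(edim j) -> 'I_(edim i) -> nat;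
  toricP : forall q,
    egen j q = \prod_(p < edim i) egen i p ^+ toric_exp q p }.

Definition model_set i : set A :=
  [set x | exists (c : k) (e : 'I_(edim i) -> nat),
     x = alg c * \prod_(p < edim i) egen i p ^+ e p].

Let model0 i : model_set i 0.
Proof. by exists 0, (fun=> 0%N); rewrite rmorph0 mul0r. Qed.

Let model_alg i c : model_set i (alg c).
Proof.
by exists c, (fun=> 0%N); rewrite big1 ?mulr1 // => p _; rewrite expr0.
Qed.

Let model1 i : model_set i 1.
Proof. by rewrite -(rmorph1 alg). Qed.

Let modelM i x y : model_set i x -> model_set i y -> model_set i (x * y).
Proof.
move=> [c [e ->]] [d [f ->]]; exists (c * d), (fun p => e p + f p)%N.
rewrite rmorphM mulrACA -big_split /=; congr (_ * _).
by apply: eq_bigr => p _; rewrite exprD.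
Qed.

Let modelN i x y : model_set i x -> null [:: x : bandification A; y] ->
  model_set i y.
Proof.
move=> [c [e xE]]; rewrite /= /ring_null /= !big_cons big_nil addr0 => xy.
exists (- c), e; rewrite rmorphN mulNr -xE.
by apply/eqP; rewrite -addr_eq0 addrC xy.
Qed.

Let model_gen i p : model_set i (egen i p).
Proof.
exists 1, (fun q => (q == p) : nat); rewrite rmorph1 mul1r (bigD1 p) //=.
rewrite eqxx expr1 big1 ?mulr1 // => q /negbTE ->; exact: expr0.
Qed.

Definition model_subband i : subband (bandification A) :=
  @Subband (bandification A) (model_set i)
    (model0 i) (model1 i) (@modelM i) (@modelN i).

Definition model_band i : band := sb_band (model_subband i).

Definition model_elt i x (mx : model_set i x) : model_band i :=
  @sb_elt _ (model_subband i) x mx.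

Definition model_coord i (p : 'I_(edim i)) : model_band i :=
  model_elt (model_gen p).

Let model_alg0 i : model_elt (model_alg i 0) = pm_zero (model_band i).
Proof. by apply: val_inj; exact: rmorph0. Qed.

Let model_alg1 i : model_elt (model_alg i 1) = pm_one (model_band i).
Proof. by apply: val_inj; exact: rmorph1. Qed.

Let model_algM i x y : model_elt (model_alg i (x * y)) =
  pm_mul (model_elt (model_alg i x)) (model_elt (model_alg i y)).
Proof. by apply: val_inj; exact: rmorphM. Qed.

Let model_alg_null i (s : seq kband) : null s ->
  null (map (fun c => model_elt (model_alg i c)) s).
Proof.
move=> /alg_null; rewrite /= /sb_null /= -map_comp.
by congr ring_null; apply: eq_map.
Qed.

Definition model_hom i : bandHom kband (model_band i) :=
  @BandHom kband (model_band i) (fun c => model_elt (model_alg i c))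
    (model_alg0 i) (model_alg1 i) (@model_algM i) (@model_alg_null i).

Definition modelUnder i : bandUnder kband := BandUnder (model_hom i).

Section Transition.
Variables (i j : closedEmbedding) (h : toricArrow i j).

Let model_sub x : model_set j x -> model_set i x.
Proof.
move=> [c [e ->]]; exists c, (fun p => \sum_q e q * toric_exp h q p)%N.
congr (_ * _); under eq_bigr do rewrite (toricP h) -prodrXl.
rewrite exchange_big /=; apply: eq_bigr => p _; rewrite -prodrXr.
by apply: eq_bigr => q _; rewrite -exprM mulnC.
Qed.

Definition model_incl (x : model_band j) : model_band i :=
  model_elt (model_sub (set_mem (valP x))).

Let model_incl0 : model_incl (pm_zero (model_band j)) = pm_zero (model_band i).
Proof. exact: val_inj. Qed.

Let model_incl1 : model_incl (pm_one (model_band j)) = pm_one (model_band i).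
Proof. exact: val_inj. Qed.

Let model_inclM x y :
  model_incl (pm_mul x y) = pm_mul (model_incl x) (model_incl y).
Proof. exact: val_inj. Qed.

Let model_incl_null (s : seq (model_band j)) :
  null s -> null (map model_incl s).
Proof. by rewrite /= /sb_null /= -map_comp. Qed.

Let model_incl_str c : model_incl (model_hom j c) = model_hom i c.
Proof. exact: val_inj. Qed.

Definition model_inclUnder : homUnder (modelUnder j) (modelUnder i) :=
  @HomUnder kband (modelUnder j) (modelUnder i)
    (BandHom model_incl0 model_incl1 model_inclM model_incl_null)
    model_incl_str.

Definition model_trans (f : points (modelUnder i)) : points (modelUnder j) :=
  hu_comp f model_inclUnder.

End Transition.

Definition lim_model : topologicalType :=
  invlim (X := fun i => points (modelUnder i)) (@model_trans).

Definition trop_map i (x : berkovich) :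
    prod_topology (fun _ : 'I_(edim i) => nnreal R) :=
  fun p => x (egen i p).

Definition trop i : set (prod_topology (fun _ : 'I_(edim i) => nnreal R)) :=
  range (@trop_map i).

Arguments trop : clear implicits.

Definition monomial_map n m (e : 'I_m -> 'I_n -> nat) (x : 'I_n -> nnreal R)
    (q : 'I_m) : nnreal R :=
  \big[@nnmul R/nn1 R]_(p < n) iter (e q p) (nnmul (x p)) (nn1 R).

Let seminorm1 (x : berkovich) : x 1 = nn1 R.
Proof. by rewrite -(rmorph1 alg) seminorm_ext absv1. Qed.

Let seminorm_mul (x : berkovich) f g : x (f * g) = nnmul (x f) (x g).
Proof. by apply: val_inj; exact: seminormM. Qed.

Let trop_trans_subproof i j (h : toricArrow i j) y :
  trop i y -> trop j (monomial_map (toric_exp h) y).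
Proof.
move=> [x _ <-]; exists x => //; apply/funext => q.
rewrite /trop_map /monomial_map (toricP h).
elim/big_ind2: _ => [|a b c d <- <-|p _]; rewrite ?seminorm1 ?seminorm_mul //.
elim: (toric_exp h q p) => [|n IH]; first by rewrite expr0 seminorm1.
by rewrite exprS seminorm_mul IH.
Qed.

Definition trop_trans i j (h : toricArrow i j) (y : set_type (trop i)) :
    set_type (trop j) :=
  exist (fun z => z \in trop j) _ (mem_set (trop_trans_subproof h (set_mem (valP y)))).

Definition lim_trop : topologicalType :=
  invlim (X := fun i => set_type (trop i)) (@trop_trans).

End Algebra.

Arguments egen {k A alg} c _.
Arguments trop {R k} v {A alg} i _.

(* Main.v *)
(* Each of the other three spaces is compared with the Berkovich space, whose
   topology is initial for the evaluations at the elements of A.  Multiplicative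
   ultrametric seminorms and band morphisms to T are the same thing.  A
   compatible family, of points of the models or of points of the
   tropicalizations, glues to a seminorm because any finitely many elements of A
   are generators of a common embedding, which moreover can be chosen to map by
   toric arrows to any two given embeddings; so every seminorm axiom, as well as
   independence of the embedding, can be checked on the generators of a single
   embedding. *)
Require Import Defs.
From HB Require Import structures.
From mathcomp Require Import all_boot all_order all_algebra.
From mathcomp Require Import all_classical all_reals all_analysis.

Set Implicit Arguments.
Unset Strict Implicit.
Unset Printing Implicit Defensive.

Import Order.TTheory GRing.Theory Num.Theory.
Import numFieldNormedType.Exports.

Local Open Scope classical_set_scope.
Local Open Scope ring_scope.

(** * Homeomorphisms and the universal properties of initial, product and limit topologies *)

Lemma homeomorphism_inv (X Y : topologicalType) (f : X -> Y) (g : Y -> X) :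
  cancel f g -> cancel g f -> continuous f -> continuous g ->
  homeomorphism g.
Proof. by move=> fK gK cf cg; exists f. Qed.

Lemma homeomorphism_comp (X Y Z : topologicalType) (g : Y -> Z) (f : X -> Y) :
  homeomorphism f -> homeomorphism g -> homeomorphism (g \o f).
Proof.
move=> [f' [fK f'K cf cf']] [g' [gK g'K cg cg']]; exists (f' \o g').
split; [exact: can_comp|exact: can_comp| |].
  by move=> x; apply: continuous_comp; [exact: cf|exact: cg].
by move=> x; apply: continuous_comp; [exact: cg'|exact: cf'].
Qed.

Section SupInitial.
Variables (T : choiceType) (I : Type) (Z : I -> topologicalType).
Variable w : forall i, T -> Z i.

Let S := sup_topology (fun i => Topological.class (initial_topology (w i))).

Lemma sup_initial_continuous i : continuous (w i : S -> Z i).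
Proof.
move=> x; have /cvg_sup/(_ i) wx : x --> (x : S) by exact: cvg_id.
by move=> U /(@initial_continuous T (Z i) (w i) x); exact: wx.
Qed.

(** The spaces of points, the Berkovich space and products all carry such a supremum topology, so
    this one criterion gives continuity into each of them. *)
Lemma continuous_sup_initial (X : topologicalType) (f : X -> S) :
  (forall i, continuous (w i \o f)) -> continuous f.
Proof.
move=> cf x; apply/cvg_sup => i.
exact: (@continuous_comp_initial T X (Z i) (w i) f (cf i)).
Qed.

End SupInitial.

Lemma prod_topology_proj_continuous (I : Type) (X : I -> topologicalType) i :
  continuous (fun f : prod_topology X => f i).
Proof.
exact: (sup_initial_continuous (w := fun i (f : forall i, X i) => f i)).
Qed.

Section InverseLimitTopology.
Variables (I : Type) (Ar : I -> I -> Type) (X : I -> topologicalType).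
Variable tr : forall i j, Ar i j -> X i -> X j.

Lemma invlim_proj_continuous i : continuous (@invlim_proj I Ar X tr i).
Proof.
move=> x; apply: (@continuous_comp _ (prod_topology X) _ set_val (@^~ i)).
  exact: initial_continuous.
exact: prod_topology_proj_continuous.
Qed.

Lemma continuous_invlim (Y : topologicalType) (f : Y -> invlim tr) :
  (forall i, continuous (@invlim_proj I Ar X tr i \o f)) -> continuous f.
Proof.
move=> cf; apply: continuous_comp_initial.
exact: continuous_sup_initial.
Qed.

Lemma invlim_eq (x y : invlim tr) :
  (forall i, invlim_proj i x = invlim_proj i y) -> x = y.
Proof. by move=> xy; apply/val_inj/functional_extensionality_dep. Qed.

Lemma invlim_projE (x : invlim tr) i j (h : Ar i j) :
  tr h (invlim_proj i x) = invlim_proj j x.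
Proof. exact: (set_mem (valP x)). Qed.

End InverseLimitTopology.

(** * Short null sums in the tropical band *)

Section TropicalNull.
Variable R : realType.

(** In the tropical band every element is its own additive inverse, and inverses are unique. *)
Lemma trop_null2 (x y : nnreal R) : trop_null [:: x; y] -> x = y.
Proof.
have [b [xb ub]] := @null_opp (trop_band R) x => xy.
have bx : b = x.
  apply: ub; apply/trop_nullP; right; rewrite /nnmax !big_cons big_nil /=.
  by rewrite maxA maxxx (max_idPl _) // eqxx.
by rewrite -(ub y xy).
Qed.

(** If [z] exceeded both [x] and [y], the maximum would be positive and occur only once. *)
Lemma trop_null3 (x y z : nnreal R) :
  trop_null [:: x; y; z] -> z%:num <= Num.max x%:num y%:num.
Proof.
move=> /trop_nullP; rewrite /nnmax !big_cons big_nil /=.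
rewrite [Num.max z%:num _](max_idPl _) // maxA leNgt => h; apply/negP => zxy.
move: h; rewrite (max_idPr (ltW zxy)).
move: zxy; rewrite gt_max => /andP[xz yz].
rewrite (lt_eqF xz) (lt_eqF yz) eqxx => -[z0|//].
by move: xz; rewrite z0 ltNge ge0.
Qed.

(** A band has no addition: the relation c = a + b is expressed by nullity of a + b + c' with c' the
    inverse of c, and [f] takes the same value at c and c'. *)
Lemma bandHom_ultra (B : band) (f : bandHom B (trop_band R)) (a b c c' : B) :
  null [:: c; c'] -> null [:: a; b; c'] ->
  (f c : nnreal R)%:num <=
    Num.max (f a : nnreal R)%:num (f b : nnreal R)%:num.
Proof.
move=> /(bh_null f) /trop_null2 -> /(bh_null f); exact: trop_null3.
Qed.

End TropicalNull.

Lemma points_eq (R : realType) (k : fieldType) (v : nonarchAbs R k)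
    (B : bandUnder (bandification k)) (f g : points v B) : f =1 g -> f = g.
Proof.
case: f g => [[f f0 f1 fM fn] fs] [[g g0 g1 gM gn] gs] /funext /= fg.
(* Once the underlying functions are identified, the proof fields have equal types and proof
   irrelevance applies. *)
case: _ / fg in g0 g1 gM gn gs *.
have -> : g0 = f0 by exact: Prop_irrelevance.
have -> : g1 = f1 by exact: Prop_irrelevance.
have -> : gM = fM by exact: Prop_irrelevance.
have e : gn = fn by exact: Prop_irrelevance.
rewrite e in gs *.
by congr HomUnder; exact: Prop_irrelevance.
Qed.

(** * Multiplicative seminorms as points over the tropical band *)

Section Algebra.
Variables (R : realType) (k : fieldType) (v : nonarchAbs R k).
Variables (A : comPzRingType) (alg : {rmorphism k -> A}).

Local Notation berk := (berkovich v alg).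
Local Notation emb := (closedEmbedding alg).

Implicit Types (x : berk) (i j l : emb) (a b : A).

Lemma berkovich_eq (x y : berk) : x =1 y -> x = y.
Proof.
case: x y => [f fM fu fe] [g gM gu ge] /funext /= fg.
case: _ / fg in gM gu ge *.
by congr Berkovich; exact: Prop_irrelevance.
Qed.

Lemma seminorm_continuous a : continuous (fun x => x a).
Proof. exact: (@sup_initial_continuous berk A _ (fun a x => x a)). Qed.

Lemma continuous_berkovich (X : topologicalType) (f : X -> berk) :
  (forall a, continuous (fun t => f t a)) -> continuous f.
Proof. exact: continuous_sup_initial. Qed.

Lemma ev_continuous (B : bandUnder (bandification k)) (b : B) :
  continuous (@ev R k v B b).
Proof. exact: sup_initial_continuous. Qed.

Lemma continuous_points (X : topologicalType) (B : bandUnder (bandification k))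
    (f : X -> points v B) :
  (forall b : B, continuous (ev b \o f)) -> continuous f.
Proof. exact: continuous_sup_initial. Qed.

(** Since [rho] recovers the value at [a] from [F x], the map [F] is injective; and the inverse is
    continuous because its evaluation at [a] is [rho]. *)
Lemma berkovich_homeomorphism (Y : topologicalType) (F : berk -> Y) :
  continuous F -> (forall y, exists x, F x = y) ->
  (forall a, exists2 rho : Y -> nnreal R,
    continuous rho & forall x, rho (F x) = x a) ->
  homeomorphism F.
Proof.
move=> cF /choice[G FG] rhoP; exists G; split=> //.
  move=> x; apply: berkovich_eq => a; have [rho _ rhoF] := rhoP a.
  by rewrite -!rhoF FG.
apply: continuous_berkovich => a; have [rho crho rhoF] := rhoP a.
by under eq_fun do rewrite -rhoF FG.
Qed.

Lemma seminorm0 x : x 0 = nn0 R.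
Proof. by rewrite -(rmorph0 alg) seminorm_ext absv0. Qed.

Lemma seminorm1 x : x 1 = nn1 R.
Proof. by rewrite -(rmorph1 alg) seminorm_ext absv1. Qed.

Lemma seminorm_mul x a b : x (a * b) = nnmul (x a) (x b).
Proof. by apply: val_inj; exact: seminormM. Qed.

Lemma seminormN x a : x (- a) = x a.
Proof.
by apply/val_inj/eqP; rewrite -(@eqrXn2 _ 2) //= !expr2 -!seminormM mulrNN.
Qed.

Lemma seminorm_sum_lt x (s : seq A) (M : R) : 0 < M ->
  (forall a, a \in s -> (x a)%:num < M) -> (x (\sum_(a <- s) a))%:num < M.
Proof.
move=> M0; elim: s => [|a s IH] sM; first by rewrite big_nil seminorm0.
rewrite big_cons; apply: le_lt_trans (seminorm_ultra _ _ _) _.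
rewrite gt_max sM ?mem_head // IH // => b bs; apply: sM.
by rewrite inE bs orbT.
Qed.

(** If a positive maximum were attained by a single term a, then a would be minus the sum of the
    other terms, whose seminorm is strictly smaller by the ultrametric inequality. *)
Lemma seminorm_null x (s : seq (bandification A)) :
  null s -> trop_null (map x s).
Proof.
move=> s0; apply/trop_nullP.
have [M0|M0] := eqVneq (nnmax (map x s)) 0; [by left|right].
have Mgt : 0 < nnmax (map x s) by rewrite lt_def M0 nnmax_ge0.
have [_ /mapP[a sa ->] aM] := nnmax_att Mgt.
rewrite count_map (permP (perm_to_rem sa)) /= aM eqxx add1n ltnS -has_count.
apply: contraPT s0 => /hasPn h; rewrite /= /ring_null /=.
rewrite (perm_big _ (perm_to_rem sa)) big_cons => /eqP.
rewrite addr_eq0 => /eqP aE.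
suff : (x (\sum_(b <- rem a s) b))%:num < nnmax (map x s).
  by rewrite -seminormN -aE aM ltxx.
apply: seminorm_sum_lt => // b br; rewrite lt_neqAle h //=.
by apply/nnmax_ub/map_f; exact: mem_rem br.
Qed.

Definition seminorm_point x : points v (algUnder alg) :=
  @HomUnder _ (algUnder alg) (tropUnder v)
    (@BandHom (bandification A) (trop_band R) x (seminorm0 x) (seminorm1 x)
       (seminorm_mul x) (@seminorm_null x))
    (seminorm_ext x).

Lemma point_seminorm (f : points v (algUnder alg)) :
  exists x, seminorm_point x = f.
Proof.
have fM (a b : A) : ((f (a * b) : nnreal R)%:num =
    (f a : nnreal R)%:num * (f b : nnreal R)%:num).
  exact: (congr1 (fun t : nnreal R => t%:num) (bhM f a b)).
have fu (a b : A) : (f (a + b) : nnreal R)%:num <=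
    Num.max (f a : nnreal R)%:num (f b : nnreal R)%:num.
  apply: (@bandHom_ultra _ _ f _ _ (a + b) (- (a + b)));
    by rewrite /= /ring_null /= !big_cons big_nil addr0 ?addrA subrr.
exists (@Berkovich R k v A alg f fM fu (hu_str f)).
exact: points_eq.
Qed.

Lemma seminorm_point_homeomorphism : homeomorphism seminorm_point.
Proof.
apply: berkovich_homeomorphism.
- by apply: continuous_points => a; exact: seminorm_continuous.
- exact: point_seminorm.
- by move=> a; exists (@ev R k v (algUnder alg) a) => //; exact: ev_continuous.
Qed.

(** * Common refinements of embeddings and gluing *)

Lemma generates_sub n m (g : 'I_n -> A) (g' : 'I_m -> A) :
  (forall q, exists p, g' p = g q) -> generates alg g -> generates alg g'.
Proof.
move=> gg' gA S Salg Sg' SD SM; apply: gA => // q.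
by have [p <-] := gg' q.
Qed.

Lemma toricArrow_of_range i j :
  (forall q, exists p, egen i p = egen j q) -> inhabited (toricArrow i j).
Proof.
move=> /choice[s sE]; constructor.
(* A 0-1 exponent matrix: the arrow is a coordinate selection. *)
exists (fun q p => (p == s q) : nat) => q.
rewrite (bigD1 (s q)) //= eqxx expr1 sE big1 ?mulr1 // => p /negbTE ->.
exact: expr0.
Qed.

(** Listing the generators of [i], those of [j] and [s] together still generates, and forgetting
    coordinates is toric. *)
Lemma embedding_refine i j (s : seq A) : exists l,
  [/\ inhabited (toricArrow l i), inhabited (toricArrow l j)
    & forall a, a \in s -> exists p, egen l p = a].
Proof.
pose t := codom (egen i) ++ codom (egen j) ++ s.
have tE a : a \in t -> exists p, tnth (in_tuple t) p = a.
  by case/seq_tnthP => p ->; exists p; rewrite (tnth_nth a).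
have ti q : exists p, tnth (in_tuple t) p = egen i q.
  by apply: tE; rewrite mem_cat codom_f.
exists (ClosedEmbedding (generates_sub ti (@egenP _ _ _ i))); split.
- exact: toricArrow_of_range.
- apply: toricArrow_of_range => q.
  by apply: tE; rewrite !mem_cat codom_f orbT.
- by move=> a sa; apply: tE; rewrite !mem_cat sa !orbT.
Qed.

Section FinitelyGenerated.
Hypothesis fgA : finitely_generated alg.

Lemma embedding_through (s : seq A) :
  exists l, forall a, a \in s -> exists p, egen l p = a.
Proof.
have [n [g gA]] := fgA; pose i := ClosedEmbedding gA.
by have [l [_ _ ls]] := embedding_refine i i s; exists l.
Qed.

(** The seminorm axioms are only required among coordinates of one embedding, which is all that a
    compatible family provides directly. *)
Lemma glue_seminorm (c : forall i, 'I_(edim i) -> nnreal R) :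
  (forall i j (h : toricArrow i j) p q,
    egen i p = egen j q -> c i p = c j q) ->
  (forall i p q r, egen i r = egen i p * egen i q ->
    c i r = nnmul (c i p) (c i q)) ->
  (forall i p q r, egen i r = egen i p + egen i q ->
    (c i r)%:num <= Num.max (c i p)%:num (c i q)%:num) ->
  (forall i p t, egen i p = alg t -> c i p = v t) ->
  exists x, forall i p, c i p = x (egen i p).
Proof.
move=> ctr cM cD calg.
have cE i j p q : egen i p = egen j q -> c i p = c j q.
  (* Both values are compared with the one at the coordinate [r] of a common refinement that
     contains the shared element. *)
  move=> pq; have [l [[hi] [hj] /(_ (egen i p))]] :=
    embedding_refine i j [:: egen i p].
  rewrite mem_head => /(_ isT) [r rE].
  by rewrite -(ctr _ _ hi _ _ rE); apply: ctr; rewrite // rE.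
(* Choose for each ring element an embedding and a coordinate representing it; by [cE] the choice
   does not affect the value. *)
have /choice[loc locE] : forall a, exists ip : {i : emb & 'I_(edim i)},
    egen (tag ip) (tagged ip) = a.
  move=> a; have [i /(_ a)] := embedding_through [:: a].
  rewrite mem_head => /(_ isT) [p pE].
  by exists (Tagged (fun i : emb => 'I_(edim i)) p).
pose x a := c _ (tagged (loc a)).
have xE i p a : egen i p = a -> x a = c i p.
  by move=> pa; apply: cE; rewrite locE.
have xM a b : (x (a * b))%:num = (x a)%:num * (x b)%:num.
  have [i iE] := embedding_through [:: a; b; a * b].
  have [|p pE] := iE a; first by rewrite !inE eqxx.
  have [|q qE] := iE b; first by rewrite !inE eqxx ?orbT.
  have [|r rE] := iE (a * b); first by rewrite !inE eqxx ?orbT.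
  rewrite (xE _ _ _ pE) (xE _ _ _ qE) (xE _ _ _ rE).
  by rewrite (cM i p q r) // rE pE qE.
have xD a b : (x (a + b))%:num <= Num.max (x a)%:num (x b)%:num.
  have [i iE] := embedding_through [:: a; b; a + b].
  have [|p pE] := iE a; first by rewrite !inE eqxx.
  have [|q qE] := iE b; first by rewrite !inE eqxx ?orbT.
  have [|r rE] := iE (a + b); first by rewrite !inE eqxx ?orbT.
  rewrite (xE _ _ _ pE) (xE _ _ _ qE) (xE _ _ _ rE).
  by apply: cD; rewrite rE pE qE.
have xalg t : x (alg t) = v t by apply: calg; rewrite locE.
by exists (Berkovich xM xD xalg) => i p; rewrite /= (xE i p).
Qed.

(** * The limit of the points of the band models *)

Let model_val_null i (s : seq (model_band i)) :
  null s -> null (map (@sb_val _ (model_subband i)) s).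
Proof. by []. Qed.

(** Restriction along this inclusion is the projection from the points of Spec A to those of the
    model of [i]. *)
Definition model_val i : homUnder (modelUnder i) (algUnder alg) :=
  @HomUnder _ (modelUnder i) (algUnder alg)
    (@BandHom (model_band i) (bandification A) (@sb_val _ (model_subband i))
      erefl erefl (fun _ _ => erefl) (@model_val_null i))
    (fun _ => erefl).

Lemma lim_model_point_subproof x :
  invlim_set (@model_trans R k v A alg)
    (fun i => hu_comp (seminorm_point x) (model_val i)).
Proof. by move=> i j h; exact: points_eq. Qed.

Definition lim_model_point x : lim_model v alg :=
  exist (fun y => y \in _) _ (mem_set (lim_model_point_subproof x)).

Lemma lim_model_pointE x i (b : model_band i) :
  invlim_proj i (lim_model_point x) b = x (sb_val b).
Proof. by []. Qed.

Lemma lim_model_glue (y : lim_model v alg) : exists x, lim_model_point x = y.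
Proof.
have yE i j (h : toricArrow i j) (b : model_band i) (b' : model_band j) :
    sb_val b = sb_val b' -> invlim_proj i y b = invlim_proj j y b'.
  move=> bb'; rewrite -(invlim_projE y h) /=; congr (invlim_proj i y _).
  exact: val_inj.
have [||||x xE] :=
    @glue_seminorm (fun i p => invlim_proj i y (model_coord p)).
- by move=> i j h p q pq; exact: yE.
- move=> i p q r rE.
  apply: etrans (bhM (invlim_proj i y) (model_coord p) (model_coord q)).
  by congr (invlim_proj i y _); exact: val_inj.
(* The inverse [c] of the coordinate [r] lies in the model, so the additive relation is a null sum
   inside it. *)
- move=> i p q r rE; have [c [rc _]] := null_opp (model_coord r).
  apply: bandHom_ultra (rc) _; move: rc.
  have valE q' : sb_val (model_coord q') = egen i q' by [].
  rewrite /= /sb_null /= /ring_null /= !big_cons !big_nil !valE rE.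
  by rewrite [egen i p + (_ + _)]addrA.
- move=> i p t pE; apply: etrans (hu_str (invlim_proj i y) t).
  by congr (invlim_proj i y _); exact: val_inj.
exists x; apply: invlim_eq => i; apply: points_eq => b.
rewrite [LHS]lim_model_pointE.
(* The element [b] need not be a coordinate of [i]; it becomes one after refinement, where [xE]
   applies. *)
have [l [[h] _ /(_ (sb_val b))]] := embedding_refine i i [:: sb_val b].
rewrite mem_head => /(_ isT) [p pE].
by rewrite -(yE _ _ h (model_coord p) b pE) xE pE.
Qed.

Lemma lim_model_point_homeomorphism : homeomorphism lim_model_point.
Proof.
apply: berkovich_homeomorphism.
- apply: continuous_invlim => i; apply: continuous_points => b.
  exact: seminorm_continuous.
- exact: lim_model_glue.
(* [rho] reads off the coordinate [p] of an embedding having [a] among its generators. *)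
- move=> a; have [i /(_ a)] := embedding_through [:: a].
  rewrite mem_head => /(_ isT) [p pE].
  exists (ev (model_coord p : modelUnder i) \o @invlim_proj _ _ _ _ i).
    move=> y; apply: continuous_comp; first exact: invlim_proj_continuous.
    exact: ev_continuous.
  by move=> x; rewrite -pE.
Qed.

(** * The limit of the tropicalizations *)

Lemma monomial_trop_map x i j (h : toricArrow i j) :
  monomial_map (toric_exp h) (trop_map (i := i) x) = trop_map (i := j) x.
Proof.
apply/funext => q; rewrite /trop_map /monomial_map (toricP h).
apply/esym; rewrite (big_morph x (seminorm_mul x) (seminorm1 x)).
apply: eq_bigr => p _; elim: (toric_exp h q p) => [|n IH].
  by rewrite expr0 seminorm1.
by rewrite exprS seminorm_mul IH.
Qed.

Definition trop_point x i : set_type (trop v i) :=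
  exist (fun z => z \in trop v i) (trop_map (i := i) x) (mem_set (imageT _ x)).

Lemma lim_trop_point_subproof x :
  invlim_set (@trop_trans R k v A alg) (trop_point x).
Proof. by move=> i j h; apply: val_inj; exact: monomial_trop_map. Qed.

Definition lim_trop_point x : lim_trop v alg :=
  exist (fun z => z \in _) _ (mem_set (lim_trop_point_subproof x)).

(** Each component of [z] comes from some seminorm, possibly a different one for each embedding;
    this suffices since every gluing condition involves one embedding or one arrow. *)
Lemma lim_trop_glue (z : lim_trop v alg) : exists x, lim_trop_point x = z.
Proof.
have zP i : exists x, trop_point x i = invlim_proj i z.
  have [x _ xz] := set_mem (valP (invlim_proj i z)).
  by exists x; exact: val_inj.
have valE x i p : set_val (trop_point x i) p = x (egen i p) by [].
have [||||x xE] :=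
    @glue_seminorm (fun i p => set_val (invlim_proj i z) p).
(* The transition map sends the component of a seminorm at [i] to that of the same seminorm at
   [j]. *)
- move=> i j h p q pq; rewrite -(invlim_projE z h).
  by have [x <-] := zP i; rewrite lim_trop_point_subproof !valE pq.
- by move=> i p q r rE; have [x <-] := zP i; rewrite !valE rE seminorm_mul.
- move=> i p q r rE; have [x <-] := zP i; rewrite !valE rE.
  exact: seminorm_ultra.
- by move=> i p t pE; have [x <-] := zP i; rewrite !valE pE seminorm_ext.
exists x; apply: invlim_eq => i; apply/val_inj/funext => p.
exact: (esym (xE i p)).
Qed.

Lemma lim_trop_point_homeomorphism : homeomorphism lim_trop_point.
Proof.
apply: berkovich_homeomorphism.
- apply: continuous_invlim => i; apply: continuous_comp_initial.
  apply: continuous_sup_initial => p; exact: seminorm_continuous.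
- exact: lim_trop_glue.
- move=> a; have [i /(_ a)] := embedding_through [:: a].
  rewrite mem_head => /(_ isT) [p pE].
  pose coord (t : set_type (trop v i)) : nnreal R := set_val t p.
  have ccoord : continuous coord.
    move=> t; apply: (@continuous_comp _ (prod_topology _) _ set_val (@^~ p)).
      exact: initial_continuous.
    exact: prod_topology_proj_continuous.
  exists (coord \o @invlim_proj _ _ _ _ i); last by move=> x; rewrite -pE.
  move=> z; apply: continuous_comp; first exact: invlim_proj_continuous.
  exact: ccoord.
Qed.

End FinitelyGenerated.

End Algebra.

Theorem corollary4p3 (R : realType) (k : fieldType) (v : nonarchAbs R k)
    (A : comPzRingType) (alg : {rmorphism k -> A})
    (fgA : finitely_generated alg) :
  exists (Phi1 : berkovich v alg -> points v (algUnder alg))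
         (Phi2 : points v (algUnder alg) -> lim_model v alg)
         (Phi3 : lim_model v alg -> lim_trop v alg),
    [/\ homeomorphism Phi1, homeomorphism Phi2 & homeomorphism Phi3] /\
    [/\ forall (x : berkovich v alg) (a : A), Phi1 x a = x a,
        forall (f : points v (algUnder alg)) (i : closedEmbedding alg)
          (b : model_band i), invlim_proj i (Phi2 f) b = f (sb_val b)
      & forall (y : lim_model v alg) (i : closedEmbedding alg)
          (p : 'I_(edim i)),
          set_val (invlim_proj i (Phi3 y)) p =
          invlim_proj i y (model_coord p)].
Proof.
have [g2 [g2K Kg2 c2 cg2]] := seminorm_point_homeomorphism v alg.
have [g3 [g3K Kg3 c3 cg3]] := lim_model_point_homeomorphism v fgA.
have h4 := lim_trop_point_homeomorphism v fgA.
exists (@seminorm_point R k v A alg), (@lim_model_point R k v A alg \o g2),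
  (@lim_trop_point R k v A alg \o g3); split; split.
- exact: seminorm_point_homeomorphism.
- apply: homeomorphism_comp; first exact: homeomorphism_inv Kg2 c2 cg2.
  exact: lim_model_point_homeomorphism.
- by apply: homeomorphism_comp => //; exact: homeomorphism_inv Kg3 c3 cg3.
- by [].
(* Writing [f] as the point of the seminorm [g2 f] makes both sides the same evaluation. *)
- by move=> f i b; rewrite -[in RHS](Kg2 f).
- by move=> y i p; rewrite -[in RHS](Kg3 y).
Qed.
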